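(* Let $p$ be a prime, $n$ a positive integer with $p\mid n$ and $p^2\nmid n$, and $G=\mathbb{Z}_{p^2}\times\mathbb{Z}_n$. Let $d_1,\dots,d_k$ be all the divisors of $n$, ordered so that the first $c$ are relatively prime to $p^2$ and the next $k-c$ are divisible by $p$. Let $S_1,\dots,S_l$, with $l=c+(p+1)(k-c)+pc$, be the list of all cyclic subgroups of $G$. Then $$\psi(A(\mathscr{P}(G)),x)=(1+x)^{\alpha}\,\psi(Q,x),$$ where $$\alpha=\sum_{i=1}^{c}(\phi(d_i)-1)+(p+1)\sum_{i=c+1}^{k}(\phi(d_i)-1)+p\sum_{i=1}^{c}(\phi(d_ip^2)-1)$$ and $Q=(q_{ij})_{l\times l}$ with $$q_{ij}=\begin{cases}\phi(|S_j|)&\text{if } i\neq j\text{ and }T_{S_i}\sim T_{S_j},\\ \phi(|S_i|)-1&\text{if } i=j,\\ 0&\text{otherwise.}\end{cases}$$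
   Context: For a finite group $G$, the power graph $\mathscr{P}(G)$ is the simple graph with vertex set $G$ in which two distinct vertices $x,y$ are adjacent iff $x=y^k$ or $y=x^k$ for some $k\in\mathbb{N}$. $A(H)$ is the adjacency matrix of a graph $H$; for a square matrix $N$, $\psi(N,x)=\det(xI-N)$. $\phi$ is Euler's totient function. For a cyclic subgroup $C$, $T_C$ denotes the set of all generators of $C$. For disjoint vertex sets $X,Y$, $X\sim Y$ means every vertex of $X$ is adjacent to every vertex of $Y$ (in $\mathscr{P}(G)$). The list $S_1,\dots,S_l$ contains each cyclic subgroup of $G$ exactly once; its order is immaterial, since reordering conjugates $Q$ by a permutation matrix. *)

(* Defs.v *)
From mathcomp Require Import all_boot all_order all_algebra all_fingroup all_solvable.

Set Implicit Arguments.
Unset Strict Implicit.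
Unset Printing Implicit Defensive.

Import GRing.Theory.
Local Open Scope ring_scope.

(* The group Z_{p^2} x Z_n with its additive law, written multiplicatively.
   The MathComp type 'Z_m is the integers mod m only when 1 < m, which is the
   case here for m = p ^ 2 (p prime) and for m = n (p %| n and 0 < n). *)
Definition Zp2xZn (p n : nat) : finGroupType := ('Z_(p ^ 2)%N * 'Z_n)%type.

Lemma Zp2xZn_mulE (p n : nat) (x y : Zp2xZn p n) :
  (x * y)%g = (x.1 + y.1, x.2 + y.2).
Proof. by []. Qed.

Lemma card_Zp2xZn (p n : nat) :
  prime p -> (0 < n)%N -> (p %| n)%N -> #|Zp2xZn p n| = (p ^ 2 * n)%N.
Proof.
move=> p_pr n_gt0 pn; have p_gt1 := prime_gt1 p_pr.
have n_gt1 : (1 < n)%N := leq_trans p_gt1 (dvdn_leq n_gt0 pn).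
have p2_gt1 : (1 < p ^ 2)%N by rewrite -(exp1n 2) ltn_exp2r.
by rewrite card_prod !card_ord !Zp_cast.
Qed.

(* Adjacency in the power graph; see power_graphP. *)
Definition power_graph (gT : finGroupType) : rel gT :=
  fun x y => (x != y) && ((x \in <[y]>%g) || (y \in <[x]>%g)).

(* Allowing the exponent 0 changes nothing, since 1 = y ^+ #[y]. *)
Lemma power_graphP (gT : finGroupType) (x y : gT) :
  reflect (x <> y /\ ((exists k : nat, x = (y ^+ k)%g) \/
                      (exists k : nat, y = (x ^+ k)%g)))
          (power_graph x y).
Proof.
apply: (iffP andP) => [[/eqP nxy /orP Hxy] | [nxy Hxy]].
  by split=> //; case: Hxy => /cycleP[k Hk]; [left | right]; exists k.
split; first exact/eqP.
by apply/orP; case: Hxy => Hk; [left | right]; apply/cycleP.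
Qed.

Definition adjacency_mx (T : finType) (e : rel T) : 'M[int]_#|T| :=
  \matrix_(i, j) (e (enum_val i) (enum_val j))%:R.

Definition generators (gT : finGroupType) (C : {set gT}) : {set gT} :=
  [set x | generator C x].

Definition fully_adjacent (T : finType) (e : rel T) (X Y : {set T}) : bool :=
  [forall x in X, forall y in Y, e x y].

Definition quotient_mx (gT : finGroupType) (l : nat)
    (S : 'I_l -> {group gT}) : 'M[int]_l :=
  \matrix_(i, j)
    if i == j then (totient #|S i|)%:R - 1
    else if fully_adjacent (@power_graph gT)
              (generators (S i)) (generators (S j))
    then (totient #|S j|)%:R
    else 0.

(* Main.v *)
(* Elements generating the same cyclic subgroup are pairwise adjacent and have
   the same other neighbours, so A + 1 = U M U^T, where U is the incidence
   matrix of elements against the cyclic subgroups they generate, while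
   M U^T U = Q + 1. Sylvester's determinant identity then relates the two
   characteristic polynomials up to the power |G| - l of 1 + x, in any finite
   group G. In Z_{p^2} x Z_n the number l is the sum over x in G of
   1/phi(|x|); with n = p m and p not dividing m it splits over the divisors
   of m, each contributing 2p + 2. Finally alpha = |G| - l because phi(e) sums
   to m over the divisors e of m. *)
Require Import Defs.
From mathcomp Require Import all_boot all_order all_algebra all_fingroup all_solvable.
From mathcomp Require Import ring zify.

Set Implicit Arguments.
Unset Strict Implicit.
Unset Printing Implicit Defensive.

Import GRing.Theory Num.Theory.
Local Open Scope ring_scope.

(** * Sylvester's determinant identity and shifted characteristic polynomials *)

Lemma det_scalar_sub_mulmx_sym (R : comPzRingType) (m n : nat) (t : R)
    (U : 'M[R]_(m, n)) (V : 'M[R]_(n, m)) :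
  t ^+ n * \det (t%:M - U *m V) = t ^+ m * \det (t%:M - V *m U).
Proof.
(* A unitriangular factor on the right of [B] clears [V] and leaves the block [t - U V]. The factor
   used on the left clears the same block and leaves [t - V U], at the cost of [t ^+ n]. *)
pose B := block_mx t%:M U V 1%:M.
have <-: \det B = \det (t%:M - U *m V).
  have <-: \det (B *m block_mx 1%:M 0 (- V) 1%:M) = \det B.
    by rewrite det_mulmx det_lblock !det1 !mulr1.
  rewrite mulmx_block !mulmx1 !mulmx0 !mul1mx !add0r mulmxN subrr.
  by rewrite det_ublock det1 mulr1.
have <-: \det (block_mx 1%:M 0 (- V) t%:M *m B) = t ^+ n * \det B.
  by rewrite det_mulmx det_lblock det1 det_scalar mul1r.
rewrite mulmx_block !mul1mx !mul0mx !addr0 mulmx1 mulNmx.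
rewrite mul_mx_scalar mul_scalar_mx addNr det_ublock det_scalar.
by rewrite mulNmx addrC.
Qed.

(** Subtracting the identity turns ['X] into [1 + 'X] in the characteristic matrix, so Sylvester's
    identity applies with [t = 1 + 'X]. The common power cancels because [1 + 'X] is monic over an
    integral domain. *)
Lemma char_poly_mulmx_sub1 (R : idomainType) (a m n : nat)
    (U : 'M[R]_(m, n)) (V : 'M[R]_(n, m)) : m = (a + n)%N ->
  char_poly (U *m V - 1%:M) = (1 + 'X) ^+ a * char_poly (V *m U - 1%:M).
Proof.
have charE q (A : 'M[R]_q) :
    char_poly (A - 1%:M) = \det ((1 + 'X)%:M - map_mx polyC A).
  have ->: (1 + 'X)%:M = 1%:M + 'X%:M :> 'M[{poly R}]_q
    by apply/matrixP=> i j; rewrite !mxE mulrnDl.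
  by rewrite /char_poly /char_poly_mx map_mxB map_mx1 opprB addrCA addrA.
move=> m_eq; rewrite !charE !map_mxM; apply: (@mulfI _ ((1 + 'X) ^+ n)).
  by rewrite expf_neq0 // addrC monic_neq0 // -[1]opprK -polyCN monicXsubC.
by rewrite mulrA -exprD addnC -m_eq det_scalar_sub_mulmx_sym.
Qed.

(** * The power graph of a finite group and its cyclic subgroups *)

Section CyclicSubgroups.

Variables (gT : finGroupType) (l : nat) (S : 'I_l -> {group gT}).
Hypotheses (S_inj : injective S)
  (S_cyclic : forall H : {group gT}, cyclic H <-> exists i, S i = H).

Lemma card_generators (i : 'I_l) : #|generators (S i)| = totient #|S i|.
Proof.
have /cyclicP[a defS]: cyclic (S i) by apply/S_cyclic; exists i.
by rewrite /generators defS -[#|<[a]>%g|]/(#[a]%g) totient_gen.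
Qed.

(** The fibres of [f] are the classes of elements generating the same subgroup: completeness of the
    list [S] gives an index for each element, injectivity makes it unique. *)
Lemma exists_cycle_index : exists f : gT -> 'I_l,
  forall x i, generator (S i) x = (f x == i).
Proof.
have: forall x, exists i, S i = <[x]>%G by move=> x; apply/S_cyclic/cycle_cyclic.
case/fin_all_exists=> f Sf; exists f => x i.
by rewrite /generator eq_sym -[<[x]>%g]/(<[x]>%G : {set gT}) -Sf val_eqE (inj_eq S_inj).
Qed.

(** Adjacency of two generators depends only on the subgroups they generate, since [i != j] forces
    the elements to differ. Both sets of generators are nonempty, so the universal statement is not
    vacuous. *)
Lemma fully_adjacent_generators (i j : 'I_l) : i != j ->
  fully_adjacent (@power_graph gT) (generators (S i)) (generators (S j))
    = (S i \subset S j) || (S j \subset S i).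
Proof.
move=> neq_ij.
have adjE x y : generator (S i) x -> generator (S j) y ->
    power_graph x y = (S i \subset S j) || (S j \subset S i).
  move=> /eqP Six /eqP Sjy; rewrite /power_graph Six Sjy !cycle_subG.
  case: eqP => [eq_xy | //]; case/eqP: neq_ij.
  by apply/S_inj/val_inj; rewrite /= Six Sjy eq_xy.
have /cyclicP[a Sia]: cyclic (S i) by apply/S_cyclic; exists i.
have /cyclicP[b Sjb]: cyclic (S j) by apply/S_cyclic; exists j.
have Sa : generator (S i) a by rewrite Sia generator_cycle.
have Sb : generator (S j) b by rewrite Sjb generator_cycle.
apply/forall_inP/idP => [adj | comparable x].
  have /forall_inP/(_ b) : [forall y in generators (S j), power_graph a y].
    by apply: adj; rewrite inE.
  by rewrite inE (adjE a b) //; apply.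
rewrite inE => Sx; apply/forall_inP=> y; rewrite inE => Sy.
by rewrite (adjE x y).
Qed.

Lemma char_poly_power_graph (a : nat) : #|gT| = (a + l)%N ->
  char_poly (adjacency_mx (@power_graph gT))
    = (1 + 'X) ^+ a * char_poly (quotient_mx S).
Proof.
have [f genE] := exists_cycle_index => card_gT.
have Sf x : S (f x) = <[x]>%g :> {set gT}.
  by apply/eqP; rewrite -/(generator (S (f x)) x) genE.
pose U : 'M[int]_(#|gT|, l) := \matrix_(i, j) (f (enum_val i) == j)%:R.
(* The diagonal entries of [M] are 1, so [U M U^T] joins all elements of one class, loops included;
   subtracting the identity removes exactly the loops. *)
pose M : 'M[int]_l := \matrix_(i, j) ((S i \subset S j) || (S j \subset S i))%:R.
have sum_f (F : 'I_l -> int) i : \sum_j (f i == j)%:R * F j = F (f i).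
  rewrite (bigD1 (f i)) //= eqxx mul1r big1 ?addr0 // => j.
  by rewrite eq_sym => /negPf->; rewrite mul0r.
have UM i j : (U *m M) i j = M (f (enum_val i)) j.
  by rewrite mxE -(sum_f (M^~ j)); apply: eq_bigr => k _; rewrite mxE.
have UMU : adjacency_mx (@power_graph gT) = (U *m M) *m U^T - 1%:M.
  apply/matrixP=> i j; rewrite !mxE.
  have ->: \sum_k (U *m M) i k * U^T k j = M (f (enum_val i)) (f (enum_val j)).
    by rewrite -sum_f; apply: eq_bigr => k _; rewrite UM mulrC 2!mxE.
  rewrite !mxE !Sf !cycle_subG /power_graph (inj_eq enum_val_inj).
  by case: eqP => [-> | _]; rewrite ?cycle_id ?subrr ?subr0.
have UU i j : (U^T *m U) i j = (i == j)%:R * (totient #|S j|)%:R.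
  rewrite mxE (reindex _ (onW_bij _ (enum_rank_bij gT))) /=.
  under eq_bigr do rewrite !mxE enum_rankK.
  rewrite -card_generators -sum1_card natr_sum mulr_sumr [RHS]big_mkcond /=.
  apply: eq_bigr => x _; rewrite inE genE mulr1; case: (f x =P j) => [->|_].
    by rewrite mulr1 eq_sym.
  by rewrite mulr0.
(* With the bracketing [U (M U^T)], exchanging the factors yields [M (U^T U)], where [U^T U] is the
   diagonal matrix of class sizes. *)
rewrite UMU -mulmxA (char_poly_mulmx_sub1 _ _ card_gT) -mulmxA.
congr (_ * char_poly _); apply/matrixP=> i j.
rewrite !mxE (bigD1 j) //= UU eqxx mul1r big1 => [|k /negPf neq_kj]; last first.
  by rewrite UU neq_kj mul0r mulr0.
rewrite addr0 !mxE; case: eqP => [-> | /eqP neq_ij].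
  by rewrite subxx mul1r.
by rewrite fully_adjacent_generators //; case: ifP; rewrite subr0 ?mul1r ?mul0r.
Qed.

(** The class of [S i] has [totient #|S i|] elements, each contributing the inverse of that number,
    so every cyclic subgroup counts for 1. *)
Lemma sum_inv_totient_order :
  \sum_(x : gT) (totient #[x]%g)%:R^-1 = l%:R :> rat.
Proof.
have [f genE] := exists_cycle_index.
rewrite (partition_big f xpredT) //= -[l in RHS]card_ord -sum1_card natr_sum.
apply: eq_bigr => i _.
have Sf x : f x == i -> S i = <[x]>%g :> {set gT}.
  by rewrite -genE => /eqP.
under eq_bigr => x fx do rewrite /order -Sf //.
have card_i : #|[pred x | f x == i]| = totient #|S i|.
  by rewrite -card_generators; apply: eq_card => x; rewrite !inE genE.
rewrite sumr_const card_i -[LHS]mulr_natl divff // pnatr_eq0 -lt0n.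
by rewrite totient_gt0 cardG_gt0.
Qed.

End CyclicSubgroups.

(** * Element orders in cyclic groups and in direct products *)

Lemma card_order_eq (gT : finGroupType) (G : {group gT}) (m : nat) :
  cyclic G -> (m %| #|G|)%N -> #|[pred x in G | #[x]%g == m]| = totient m.
Proof.
case/cyclicP=> a ->{G} /[dup] mG /cycle_sub_group/setP subE.
(* [b] generates the unique subgroup of order [m], so the elements of order [m] are precisely the
   generators of [<[b]>]. *)
set b := (a ^+ _)%g in subE.
have ob : #[b]%g = m by have:= subE <[b]>%G; rewrite !inE eqxx => /andP[_ /eqP].
rewrite -ob totient_gen; apply: eq_card => x; rewrite !inE /generator ob.
have:= subE <[x]>%G; rewrite !inE cycle_subG eq_sym => ->.
by rewrite eq_sym -val_eqE.
Qed.

Lemma sum_order_cyclic (R : nmodType) (gT : finGroupType) (G : {group gT})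
    (f : nat -> R) : cyclic G ->
  \sum_(x in G) f #[x]%g = \sum_(m <- divisors #|G|) f m *+ totient m.
Proof.
move=> cycG.
transitivity (\sum_(x in G) \sum_(m <- divisors #|G| | #[x]%g == m) f m).
  apply: eq_bigr => x Gx; rewrite -big_filter.
  suff ->: [seq m <- divisors #|G| | #[x]%g == m] = [:: #[x]%g].
    by rewrite big_seq1.
  under eq_filter do rewrite eq_sym.
  rewrite -/(pred1 _) filter_pred1_uniq ?divisors_uniq //.
  by rewrite -dvdn_divisors ?cardG_gt0 // order_dvdG.
under eq_bigr do rewrite big_mkcond /=.
rewrite exchange_big /= big_seq [RHS]big_seq; apply: eq_bigr => m.
rewrite -dvdn_divisors ?cardG_gt0 // => mG.
by rewrite -big_mkcondr /= sumr_const (card_order_eq cycG).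
Qed.

Lemma order_pair (gT1 gT2 : finGroupType) (x : gT1) (y : gT2) :
  #[(x, y) : gT1 * gT2]%g = lcmn #[x]%g #[y]%g.
Proof.
have expE k : (((x, y) : gT1 * gT2) ^+ k = (x ^+ k, y ^+ k))%g.
  by elim: k => // k IHk; rewrite !expgS IHk.
apply/eqP; rewrite eqn_dvd; apply/andP; split.
  rewrite order_dvdn expE; apply/eqP; congr (_, _); apply/eqP.
    by rewrite -order_dvdn dvdn_lcml.
  by rewrite -order_dvdn dvdn_lcmr.
have: ((x, y) ^+ #[(x, y) : gT1 * gT2] = 1 :> gT1 * gT2)%g by exact: expg_order.
by rewrite expE => -[ex ey]; rewrite dvdn_lcm !order_dvdn ex ey !eqxx.
Qed.

Lemma cyclic_Zp (m : nat) : cyclic [set: 'Z_m].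
Proof. by rewrite Zp_cycle cycle_cyclic. Qed.

(** * Sums over divisors *)

Lemma big_divisors_mul_prime (R : Type) (idx : R) (op : Monoid.com_law idx)
    (p m : nat) (F : nat -> R) : prime p -> (0 < m)%N -> ~~ (p %| m)%N ->
  \big[op/idx]_(e <- divisors (p * m)) F e
    = op (\big[op/idx]_(e <- divisors m) F e)
         (\big[op/idx]_(e <- divisors m) F (p * e)%N).
Proof.
move=> p_pr m_gt0 pm.
have p_gt0 := prime_gt0 p_pr.
have mulpI : injective (muln p) by move=> a b /eqP; rewrite eqn_pmul2l // => /eqP.
(* The divisors of [p * m] are those of [m] and their multiples by [p]; the two lists are disjoint
   because [p] does not divide [m]. *)
rewrite -(big_map (muln p) xpredT F) -big_cat; apply: perm_big.
apply: uniq_perm; rewrite ?divisors_uniq //.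
  rewrite cat_uniq map_inj_uniq ?divisors_uniq ?andbT //=.
  apply/hasPn=> _ /mapP[e _ ->]; rewrite /= -dvdn_divisors //.
  by apply: contra pm; apply: dvdn_trans; apply: dvdn_mulr.
move=> e; rewrite mem_cat -!dvdn_divisors ?muln_gt0 ?p_gt0 //.
have [/dvdnP[e' ->] | pe] := boolP (p %| e)%N.
  rewrite mulnC dvdn_pmul2l // mem_map; last exact: mulpI.
  rewrite -dvdn_divisors // orb_idl //.
  by move/(dvdn_trans (dvdn_mulr _ (dvdnn p))) => pm'; rewrite pm' in pm.
rewrite Gauss_dvdr; last by rewrite coprime_sym prime_coprime.
by rewrite orb_idr // => /mapP[e' _ e_eq]; rewrite e_eq dvdn_mulr in pe.
Qed.

Lemma sum_totient_divisors (m : nat) : (0 < m)%N ->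
  (\sum_(e <- divisors m) totient e = m)%N.
Proof.
move=> m_gt0; rewrite -[RHS]sum_totient_dvd -(big_mkord (dvdn^~ m)) -[RHS]big_filter.
apply: perm_big; apply: uniq_perm; rewrite ?divisors_uniq ?filter_uniq ?iota_uniq // => e.
rewrite mem_filter mem_index_iota -dvdn_divisors // ltnS.
by rewrite andb_idr // => /dvdn_leq->.
Qed.

(** Positivity of [F] keeps the truncated subtraction exact; moving the ones to the other side
    avoids subtraction later. *)
Lemma sum_subn1_divisors (m : nat) (F : nat -> nat) :
  (forall e, (e %| m)%N -> (0 < F e)%N) -> (0 < m)%N ->
  (\sum_(e <- divisors m) (F e - 1) + size (divisors m)
     = \sum_(e <- divisors m) F e)%N.
Proof.
move=> F_gt0 m_gt0; rewrite -sum1_size -big_split /= !big_seq.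
by apply: eq_bigr => e; rewrite -dvdn_divisors // => /F_gt0/subnK.
Qed.

Lemma perm_divisors_prime_sqr (p : nat) : prime p ->
  perm_eq (divisors (p ^ 2)) [:: 1; p; p ^ 2]%N.
Proof.
move=> p_pr; have p_gt1 := prime_gt1 p_pr.
have p_lt : (p < p ^ 2)%N by rewrite -[X in (X < _)%N]expn1 ltn_exp2l.
apply: uniq_perm; rewrite ?divisors_uniq //= ?inE.
  by rewrite !ltn_eqF // (ltn_trans p_gt1).
move=> e; rewrite -dvdn_divisors ?expn_gt0 ?prime_gt0 // !inE.
apply/(dvdn_pfactor _ _ p_pr)/idP => [[[|[|[|j]]] // _ ->] | ].
- by rewrite expn0.
- by rewrite expn1 eqxx orbT.
- by rewrite eqxx !orbT.
by case/or3P=> /eqP->; [exists 0 | exists 1 | exists 2].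
Qed.

(** * The number of cyclic subgroups of the group *)

Lemma sum_inv_totient_order_Zp2xZn (p m : nat) :
  prime p -> (0 < m)%N -> ~~ (p %| m)%N ->
  \sum_(x : Zp2xZn p (p * m)) (totient #[x]%g)%:R^-1
    = ((2 * p + 2) * size (divisors m))%:R :> rat.
Proof.
move=> p_pr m_gt0 pm; have [p_gt1 p_gt0] := (prime_gt1 p_pr, prime_gt0 p_pr).
have p2_gt1 : (1 < p ^ 2)%N by rewrite -(exp1n 2) ltn_exp2r.
have pm_gt1 : (1 < p * m)%N by rewrite (leq_trans p_gt1) // leq_pmulr.
have sumZ k (f : nat -> rat) : (1 < k)%N ->
    \sum_(x : 'Z_k) f #[x]%g = \sum_(e <- divisors k) f e * (totient e)%:R.
  move=> k_gt1; have := sum_order_cyclic f (cyclic_Zp k).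
  rewrite cardsT card_ord [X in divisors X]Zp_cast // => sumE.
  under [RHS]eq_bigr do rewrite mulr_natr.
  by rewrite -sumE; apply: eq_bigl => x; rewrite inE.
(* The pairs are grouped by the orders [e] and [e'] of their components; the order of a pair is the
   lcm. *)
transitivity (\sum_(e <- divisors (p ^ 2)) \sum_(e' <- divisors (p * m))
    (totient (lcmn e e'))%:R^-1 * (totient e')%:R * (totient e)%:R : rat).
  under [RHS]eq_bigr do rewrite -mulr_suml.
  rewrite -(sumZ _ (fun e => \sum_(e' <- divisors (p * m))
    (totient (lcmn e e'))%:R^-1 * (totient e')%:R)) //.
  under [RHS]eq_bigr => x _.
    rewrite -(sumZ _ (fun e' => (totient (lcmn #[x]%g e'))%:R^-1)) //; over.
  by rewrite pair_bigA; apply: eq_bigr => -[x y] _; rewrite -order_pair.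
rewrite exchange_big /= big_divisors_mul_prime // -big_split natrM mulrC.
rewrite -[LHS]mul1r -[size _]sum1_size natr_sum mulr_suml mul1r !big_seq /=.
apply: eq_bigr => e; rewrite -dvdn_divisors // => em.
rewrite !(perm_big _ (perm_divisors_prime_sqr p_pr)) !big_cons !big_nil.
have e_gt0 := dvdn_gt0 m_gt0 em.
have co : coprime p e.
  by rewrite prime_coprime //; apply: contra pm => /dvdn_trans; apply.
have co2 : coprime (p ^ 2) e by rewrite coprimeXl.
have lcm_co a : coprime a e -> lcmn a e = (a * e)%N.
  by move=> /eqP co_ae; rewrite -muln_lcm_gcd co_ae muln1.
have lcm1 : lcmn 1 (p * e) = (p * e)%N by apply/lcmn_idPr.
have lcmp : lcmn p (p * e) = (p * e)%N by apply/lcmn_idPr/dvdn_mulr.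
have lcmp2 : lcmn (p ^ 2) (p * e) = (p ^ 2 * e)%N.
  by rewrite !expnS expn0 muln1 -!mulnA -muln_lcmr lcm_co.
rewrite lcm1 lcmp lcmp2 !lcm_co ?coprime1n // mul1n.
rewrite !(totient_coprime co, totient_coprime co2) (totient_pfactor p_pr) // (totient_prime p_pr).
rewrite !expn1 ![(_ * _)%:R]natrM /=.
have p0 : p%:R != 0 :> rat by rewrite pnatr_eq0 -lt0n.
have q0 : p.-1%:R != 0 :> rat by rewrite pnatr_eq0 -lt0n -subn1 subn_gt0.
have t0 : (totient e)%:R != 0 :> rat by rewrite pnatr_eq0 -lt0n totient_gt0.
(* For fixed [e], six pairs of orders remain. The pairs [(p, p e)] and [(p ^ 2, p e)] contribute
   [p - 1] each, the other four contribute 1. *)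
have ->: (2 * p + 2)%:R = 4 + 2 * p.-1%:R :> rat.
  by rewrite -[p in LHS]prednK // natrD natrM -natr1; ring.
have ->: (totient 1)%:R = 1 :> rat by [].
by field; rewrite p0 q0 t0.
Qed.

(** * Comparison of the exponent with the group order minus the number of cyclic subgroups *)

Theorem theorem5p2 (p n : nat) (p_pr : prime p) (n_gt0 : (0 < n)%N)
  (p_dvd_n : (p %| n)%N) (p2_ndvd_n : ~~ (p ^ 2 %| n)%N)
  (k c : nat) (d : 'I_k -> nat) (d_inj : injective d)
  (d_divisors : forall m : nat, (m %| n)%N <-> exists i, d i = m)
  (c_le_k : (c <= k)%N)
  (d_coprime : forall i : 'I_k, (i < c)%N -> coprime (d i) (p ^ 2))
  (d_dvd : forall i : 'I_k, (c <= i)%N -> (p %| d i)%N)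
  (l : nat) (S : 'I_l -> {group Zp2xZn p n}) (S_inj : injective S)
  (S_cyclic : forall H : {group Zp2xZn p n}, cyclic H <-> exists i, S i = H) :
  let alpha :=
    (\sum_(i < k | (i < c)%N) (totient (d i) - 1)
     + (p + 1) * \sum_(i < k | (c <= i)%N) (totient (d i) - 1)
     + p * \sum_(i < k | (i < c)%N) (totient (d i * p ^ 2) - 1))%N in
  l = (c + (p + 1) * (k - c) + p * c)%N /\
  char_poly (adjacency_mx (@power_graph (Zp2xZn p n)))
    = (1 + 'X) ^+ alpha * char_poly (quotient_mx S).
Proof.
have p_gt0 := prime_gt0 p_pr.
have card_G := card_Zp2xZn p_pr n_gt0 p_dvd_n.
have [m n_eq] : exists m, n = (p * m)%N.
  by have /dvdnP[m ->] := p_dvd_n; exists m; rewrite mulnC.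
have m_gt0 : (0 < m)%N by move: n_gt0; rewrite n_eq muln_gt0 => /andP[].
have pm : ~~ (p %| m)%N.
  by apply: contra p2_ndvd_n; rewrite n_eq expnS expn1 dvdn_pmul2l.
have p_ndvd e : (e %| m)%N -> ~~ (p %| e)%N.
  by move=> em; apply: contra pm => /dvdn_trans; apply.
have lt_cE (i : 'I_k) : (i < c)%N = ~~ (p %| d i)%N.
  case: leqP => [/d_dvd-> // | /d_coprime].
  by rewrite coprime_pexpr // coprime_sym prime_coprime.
have ge_cE (i : 'I_k) : (c <= i)%N = (p %| d i)%N by rewrite leqNgt lt_cE negbK.
(* Sums over the indexing [d] become sums over the divisors of [m]; taking for [P] divisibility by
   [p] or its negation selects one half. *)
have sum_d (P : pred nat) (F : nat -> nat) :
    (\sum_(i < k | P (d i)) F (d i) = \sum_(e <- divisors m | P e) F e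
       + \sum_(e <- divisors m | P (p * e)) F (p * e))%N.
  rewrite -(big_map d) (perm_big (divisors n)) /=; last first.
    apply: uniq_perm; rewrite ?divisors_uniq ?map_inj_uniq ?index_enum_uniq //.
    move=> e; rewrite -dvdn_divisors //; apply/mapP/idP => [[i _ ->] | /d_divisors[i]].
      by apply/d_divisors; exists i.
    by exists i; rewrite ?mem_index_enum.
  by rewrite big_mkcond n_eq big_divisors_mul_prime //= -!big_mkcond.
have sum_lt F : (\sum_(i < k | (i < c)%N) F (d i) = \sum_(e <- divisors m) F e)%N.
  rewrite (eq_bigl _ _ lt_cE).
  rewrite (sum_d [pred e | ~~ (p %| e)%N]) /= [X in (_ + X)%N]big_pred0 ?addn0 => [|e].
    by rewrite big_seq_cond [RHS]big_seq; apply: eq_bigl => e;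
       rewrite -dvdn_divisors // andb_idr // => /p_ndvd.
  by rewrite dvdn_mulr.
have sum_ge F : (\sum_(i < k | (c <= i)%N) F (d i)
    = \sum_(e <- divisors m) F (p * e))%N.
  rewrite (eq_bigl _ _ ge_cE).
  rewrite (sum_d [pred e | (p %| e)%N]) /= big_seq_cond big_pred0 => [|e].
    by apply: eq_bigl => e; rewrite dvdn_mulr.
  by rewrite -dvdn_divisors //; apply/negP => /andP[/p_ndvd/negP].
(* Summing the constant 1 shows that both blocks of indices have as many members as [m] has
   divisors. *)
have c_eq : c = size (divisors m).
  by rewrite -sum1_size -(sum_lt (fun=> 1)) -(big_ord_widen _ (fun=> 1)) // sum1_card card_ord.
have k_eq : (k - c = size (divisors m))%N.
  have -> : k = (c + size (divisors m))%N; last by rewrite addKn.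
  rewrite -[LHS]card_ord -sum1_card (bigID (fun i : 'I_k => (i < c)%N)) /=.
  rewrite (sum_lt (fun=> 1)) sum1_size -c_eq; congr (_ + _)%N.
  rewrite [RHS]c_eq -[RHS]sum1_size -(sum_ge (fun=> 1)).
  by apply: eq_bigl => i; rewrite -leqNgt.
have l_eq : l = (c + (p + 1) * (k - c) + p * c)%N.
  apply/eqP; rewrite -(eqr_nat rat) -(sum_inv_totient_order S_inj S_cyclic).
  move: S S_inj S_cyclic => _ _ _; rewrite n_eq sum_inv_totient_order_Zp2xZn //.
  by rewrite k_eq c_eq eqr_nat; apply/eqP; ring.
move=> alpha; split=> //; apply: char_poly_power_graph => //.
have co e : (e %| m)%N -> coprime p e.
  by move=> /p_ndvd; rewrite prime_coprime.
have tot_gt0 e : (e %| m)%N -> (0 < totient e)%N.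
  by move=> em; rewrite totient_gt0 (dvdn_gt0 m_gt0 em).
(* This is used with [a] equal to [1], [p - 1] and [p (p - 1)], one value for each of the three sums
   in [alpha]. *)
have sum_tot (F : nat -> nat) a : (0 < a)%N ->
    (forall e, (e %| m)%N -> F e = a * totient e)%N ->
    (\sum_(e <- divisors m) (F e - 1) + size (divisors m) = a * m)%N.
  move=> a_gt0 F_eq; rewrite sum_subn1_divisors // => [|e em].
    rewrite -[in RHS](sum_totient_divisors m_gt0) big_distrr !big_seq /=.
    by apply: eq_bigr => e; rewrite -dvdn_divisors //; apply: F_eq.
  by rewrite F_eq // muln_gt0 a_gt0 tot_gt0.
have sum1 := @sum_tot (fun e => totient e) 1 isT (fun e _ => esym (mul1n _)).
have p1_gt0 : (0 < p.-1)%N by rewrite -subn1 subn_gt0 prime_gt1.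
have sum2 : (\sum_(e <- divisors m) (totient (p * e) - 1)
    + size (divisors m) = p.-1 * m)%N.
  by apply: sum_tot => // e /co co_e; rewrite totient_coprime // totient_prime.
have sum3 : (\sum_(e <- divisors m) (totient (e * p ^ 2) - 1)
    + size (divisors m) = (p.-1 * p) * m)%N.
  apply: sum_tot => [|e /co co_e]; first by rewrite muln_gt0 p1_gt0.
  rewrite mulnC totient_coprime ?coprimeXl //.
  by rewrite totient_pfactor.
(* Adding [l] to [alpha] restores the subtracted ones, leaving [m + (p + 1) (p - 1) m + p^2 (p - 1)
   m = p^3 m], the order of the group. *)
rewrite card_G n_eq /alpha (sum_lt (fun e => totient e - 1)%N).
rewrite (sum_lt (fun e => totient (e * p ^ 2) - 1)%N).
rewrite (sum_ge (fun e => totient e - 1)%N).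
rewrite l_eq k_eq c_eq; move: sum1 sum2 sum3.
move: (\sum_(e <- _) _)%N => A1; move: (\sum_(e <- _) _)%N => A2.
move: (\sum_(e <- _) _)%N => A3; move: (size _) => D.
by rewrite -(prednK p_gt0) => sum1 sum2 sum3; nia.
Qed.
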